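(* Let $I\subseteq\mathbb{R}$ be an interval and let $F:I\rightrightarrows\mathbb{R}$ be a lower semicontinuous set-valued function (with nonempty values). Let $J\subseteq I$ be dense in $I$ and assume that $F$ is locally pseudomonotone on $J$. Assume further that $0\notin F(x)$ for all $x\in I\setminus J$. Then $F$ is pseudomonotone on $I$.
   Context: A set-valued function $F:I\rightrightarrows\mathbb{R}$ assigns to each $x\in I$ a nonempty set $F(x)\subseteq\mathbb{R}$. A set $J\subseteq I$ is dense in $I$ if $I\subseteq \mathrm{cl}(J)$. $F$ is lower semicontinuous if for every $x\in I$ and every open $N\subseteq\mathbb{R}$ with $F(x)\cap N\neq\emptyset$ there is a neighborhood $M$ of $x$ such that $F(y)\cap N\neq\emptyset$ for all $y\in M\cap I$. Pseudomonotone (on $A\subseteq I$): for all $x,y\in A$, $x^*\in F(x)$, $y^*\in F(y)$: $x^*(y-x)\ge0\Rightarrow y^*(y-x)\ge0$. $F$ is locally pseudomonotone on $J$ if every $x\in J$ has an open neighborhood $U_x$ such that $F$ is pseudomonotone on $U_x\cap J$. *)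

(* Defs.v *)
From HB Require Import structures.
From mathcomp Require Import all_boot all_order all_algebra.
From mathcomp Require Import all_classical all_reals all_analysis.
Set Implicit Arguments.
Unset Strict Implicit.
Unset Printing Implicit Defensive.
Import Order.TTheory GRing.Theory Num.Theory.
Import numFieldNormedType.Exports.
Local Open Scope classical_set_scope.
Local Open Scope ring_scope.

(* A set-valued function on I is a total map F : R -> set R with F x nonempty
   for x in I; the values of F outside I are never used. *)

Definition nonempty_valued_on (R : realType) (I : set R) (F : R -> set R) :=
  forall x, I x -> F x !=set0.

Definition lsc_on (R : realType) (I : set R) (F : R -> set R) :=
  forall x, I x -> forall N : set R, open N -> (F x `&` N) !=set0 ->
  exists2 M : set R, nbhs x M & forall y, (M `&` I) y -> (F y `&` N) !=set0.

Definition dense_in (R : realType) (I J : set R) :=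
  J `<=` I /\ I `<=` closure J.

Definition pseudomonotone_on (R : realType) (A : set R) (F : R -> set R) :=
  forall x y xs ys, A x -> A y -> F x xs -> F y ys ->
  0 <= xs * (y - x) -> 0 <= ys * (y - x).

Definition locally_pseudomonotone_on (R : realType) (J : set R)
    (F : R -> set R) :=
  forall x, J x ->
  exists2 U : set R, open_nbhs x U & pseudomonotone_on (U `&` J) F.

(* Main.v *)
Require Import Defs.
From HB Require Import structures.
From mathcomp Require Import all_boot all_order all_algebra.
From mathcomp Require Import all_classical all_reals all_analysis.
From mathcomp Require Import lra.
Set Implicit Arguments.
Unset Strict Implicit.
Unset Printing Implicit Defensive.
Import Order.TTheory GRing.Theory Num.Theory.
Import numFieldNormedType.Exports.
Local Open Scope classical_set_scope.
Local Open Scope ring_scope.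

(** On the line, pseudomonotonicity says that for [x < y] the signs can only go
    up from [F x] to [F y].  As the values of [F] are nonempty, this relation
    between [x] and [y] is transitive, so by a supremum argument it holds on an
    interval as soon as it holds near every point.  Near a point of [J] it
    passes from [J] to [I] by lower semicontinuity and density, because an
    element of [F x] with [x] outside [J] is nonzero and its sign persists
    nearby.  Near a point [z] outside [J], all values [F t] contain, say,
    positive elements; comparing [y] in [J] with points of [J] slightly to its
    left then forces [F y] to be positive. *)

Definition sign_le (R : realType) (F : R -> set R) (x y : R) :=
  forall s t, F x s -> F y t -> (0 <= s -> 0 <= t) /\ (0 < s -> 0 < t).

(** For [x < y], the weak implication in [sign_le] is the condition for the pair [(x, y)], and the
    strict one is the contrapositive of the condition for [(y, x)]. *)
Lemma pseudomonotone_onP (R : realType) (A : set R) (F : R -> set R) :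
  pseudomonotone_on A F <->
  forall x y, A x -> A y -> x < y -> sign_le F x y.
Proof.
split=> [pmF x y Ax Ay xy s t Fs Ft|sF x y s t Ax Ay Fs Ft].
  have xy0 : 0 < y - x by rewrite subr_gt0.
  split=> s0.
    by move: (pmF x y s t Ax Ay Fs Ft); rewrite !pmulr_lge0 //; apply.
  rewrite ltNge; apply/negP => t0.
  move: (pmF y x t s Ay Ax Ft Fs).
  rewrite -(opprB y x) !mulrN !oppr_ge0 !pmulr_lle0 // => /(_ t0).
  by rewrite leNgt s0.
case: (ltgtP x y) => [xy|yx|->]; last by rewrite subrr !mulr0.
  rewrite !pmulr_lge0 ?subr_gt0 //.
  by case: (sF x y Ax Ay xy s t Fs Ft).
rewrite -(opprB x y) !mulrN !oppr_ge0 !pmulr_lle0 ?subr_gt0 //.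
case: (sF y x Ay Ax yx t s Ft Fs) => _ ts s0.
by rewrite leNgt; apply/negP => /ts; rewrite ltNge s0.
Qed.

Lemma sign_le_trans (R : realType) (F : R -> set R) (x y z : R) :
  F y !=set0 -> sign_le F x y -> sign_le F y z -> sign_le F x z.
Proof.
move=> [u Fu] xy yz s t Fs Ft.
have [xy0 xy1] := xy s u Fs Fu.
have [yz0 yz1] := yz u t Fu Ft.
by split; [move=> /xy0/yz0|move=> /xy1/yz1].
Qed.

Lemma dense_between (R : realType) (I J : set R) (a b : R) :
  is_interval I -> dense_in I J -> I a -> I b -> a < b ->
  exists2 t, J t & a < t < b.
Proof.
move=> hI [_ dJ] Ia Ib ab.
have Ic : I ((a + b) / 2) by apply: (hI _ _ Ia Ib); lra.
have /(dJ _ Ic) : nbhs ((a + b) / 2) `]a, b[%classic.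
  by apply: near_in_itvoo; rewrite in_itv /=; lra.
by case=> t [Jt /=]; rewrite in_itv /=; exists t.
Qed.

Lemma dense_right (R : realType) (I J V : set R) (a b : R) :
  is_interval I -> dense_in I J -> I a -> I b -> a < b -> nbhs a V ->
  exists t, [/\ J t, a < t < b & V t].
Proof.
move=> hI dJ Ia Ib ab /nbhs_ballP[e /= e0 eV].
(* A point of [J] below this minimum is both left of [b] and within [e] of [a]. *)
have ac : a < Num.min b (a + e) by rewrite lt_min; lra.
have cb : Num.min b (a + e) <= b by rewrite ge_min lexx.
have ce : Num.min b (a + e) <= a + e by rewrite ge_min lexx orbT.
have Ic : I (Num.min b (a + e)).
  by apply: (hI _ _ Ia Ib); lra.
have [t Jt /andP[at_ tc]] := dense_between hI dJ Ia Ic ac.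
exists t; split=> //; first by lra.
by apply: eV; rewrite /ball /= ltr_norml; lra.
Qed.

Lemma dense_left (R : realType) (I J V : set R) (a b : R) :
  is_interval I -> dense_in I J -> I a -> I b -> a < b -> nbhs b V ->
  exists t, [/\ J t, a < t < b & V t].
Proof.
move=> hI dJ Ia Ib ab /nbhs_ballP[e /= e0 eV].
have cb : Num.max a (b - e) < b by rewrite gt_max; lra.
have ac : a <= Num.max a (b - e) by rewrite le_max lexx.
have ce : b - e <= Num.max a (b - e) by rewrite le_max lexx orbT.
have Ic : I (Num.max a (b - e)).
  by apply: (hI _ _ Ia Ib); lra.
have [t Jt /andP[ct tb]] := dense_between hI dJ Ic Ib cb.
exists t; split=> //; first by lra.
by apply: eV; rewrite /ball /= ltr_norml; lra.
Qed.

Lemma lsc_pos (R : realType) (I : set R) (F : R -> set R) (z s : R) :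
  lsc_on I F -> I z -> F z s -> 0 < s ->
  exists2 M : set R, nbhs z M &
    forall y, M y -> I y -> exists2 t, F y t & 0 < t.
Proof.
move=> lscF Iz Fs s0.
have [|M zM MF] := lscF z Iz _ (@open_gt _ 0); first by exists s.
exists M => // y My Iy.
by have [t [Ft t0]] := MF y (conj My Iy); exists t.
Qed.

Lemma lsc_neg (R : realType) (I : set R) (F : R -> set R) (z s : R) :
  lsc_on I F -> I z -> F z s -> s < 0 ->
  exists2 M : set R, nbhs z M &
    forall y, M y -> I y -> exists2 t, F y t & t < 0.
Proof.
move=> lscF Iz Fs s0.
have [|M zM MF] := lscF z Iz _ (@open_lt _ 0); first by exists s.
exists M => // y My Iy.
by have [t [Ft t0]] := MF y (conj My Iy); exists t.
Qed.

(** Endpoints outside [J] are replaced by nearby points of [J] lying between [x] and [y], which stay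
    in [V] by convexity: first the left endpoint, then the right one. *)
Lemma pseudomonotone_on_dense (R : realType) (I J V : set R) (F : R -> set R) :
  is_interval I -> lsc_on I F -> dense_in I J ->
  (forall x, (I `\` J) x -> ~ F x 0) -> is_interval V ->
  pseudomonotone_on (V `&` J) F -> pseudomonotone_on (V `&` I) F.
Proof.
move=> hI lscF dJ F0 hV /pseudomonotone_onP pmJ.
have JI := dJ.1.
have neq0 x s : I x -> ~ J x -> F x s -> s != 0.
  by move=> Ix Jx Fs; apply/eqP => s0; apply: (F0 x) => //; rewrite -s0.
have IJ x y : V x -> I x -> V y -> J y -> x < y -> sign_le F x y.
  move=> Vx Ix Vy Jy xy.
  have [Jx|Jx] := pselect (J x); first exact: pmJ.
  move=> s t Fs Ft.
  suff st : 0 < s -> 0 < t.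
    split=> // s0; apply/ltW/st.
    by rewrite lt_neqAle s0 eq_sym (neq0 x).
  move=> s0; have [M xM MF] := lsc_pos lscF Ix Fs s0.
  have [u [Ju /andP[xu uy] Mu]] := dense_right hI dJ Ix (JI _ Jy) xy xM.
  have [r Fr r0] := MF u Mu (JI _ Ju).
  have Vu : V u by apply: (hV _ _ Vx Vy); lra.
  by have [_] := pmJ u y (conj Vu Ju) (conj Vy Jy) uy r t Fr Ft; apply.
apply/pseudomonotone_onP => x y [Vx Ix] [Vy Iy] xy.
have [Jy|Jy] := pselect (J y); first exact: IJ.
move=> s t Fs Ft.
have := neq0 y t Iy Jy Ft; rewrite neq_lt => /orP[t0|t0]; last first.
  by split=> // _; exact: ltW.
(* A negative [t] excludes [0 <= s]: negative values persist at some [u] in [J] left of [y], whereas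
   [IJ] would make them nonnegative. *)
have [M yM MF] := lsc_neg lscF Iy Ft t0.
have [u [Ju /andP[xu uy] Mu]] := dense_left hI dJ Ix Iy xy yM.
have [r Fr r0] := MF u Mu (JI _ Ju).
have Vu : V u by apply: (hV _ _ Vx Vy); lra.
have [sr _] := IJ x u Vx Ix Vu Ju xu s r Fs Fr.
by split=> s0; have : 0 <= r by [apply: sr; lra]; lra.
Qed.

Lemma locally_pseudomonotone_dense (R : realType) (I J : set R)
    (F : R -> set R) :
  is_interval I -> nonempty_valued_on I F -> lsc_on I F -> dense_in I J ->
  locally_pseudomonotone_on J F -> (forall x, (I `\` J) x -> ~ F x 0) ->
  forall z, I z -> exists2 M, nbhs z M & pseudomonotone_on (M `&` J) F.
Proof.
move=> hI neF lscF dJ locF F0 z Iz.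
have JI := dJ.1.
have [Jz|Jz] := pselect (J z).
  by have [U /open_nbhs_nbhs zU pmU] := locF z Jz; exists U.
have [s Fs] := neF z Iz.
have : s != 0 by apply/eqP => s0; apply: (F0 z) => //; rewrite -s0.
(* The neighbourhood [U] depends on the point of [J] but the ball around [z] does not: [u] is chosen
   in [U] between [x] and [y], so it stays in the ball and [F u] has an element of the sign of [s].
   If [s < 0], this forces [F x] to be negative and both implications are vacuous; if [0 < s], it
   forces [F y] to be positive. *)
rewrite neq_lt => /orP[s0|s0].
  have [M zM MF] := lsc_neg lscF Iz Fs s0.
  have [e /= e0 eM] := (nbhs_ballP _ _).1 zM.
  exists (ball z e); first exact: nbhsx_ballx.
  apply/pseudomonotone_onP => x y [ex Jx] [ey Jy] xy p q Fp Fq.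
  have [U /open_nbhs_nbhs xU /pseudomonotone_onP pmU] := locF x Jx.
  have [u [Ju /andP[xu uy] Uu]] := dense_right hI dJ (JI _ Jx) (JI _ Jy) xy xU.
  have [r Fr r0] : exists2 r, F u r & r < 0.
    apply: MF (JI _ Ju); apply: eM.
    by move: ex ey; rewrite /ball /= !ltr_norml; lra.
  have [pr _] := pmU x u (conj (nbhs_singleton xU) Jx) (conj Uu Ju) xu p r Fp Fr.
  by split=> p0; have : 0 <= r by [apply: pr; lra]; lra.
have [M zM MF] := lsc_pos lscF Iz Fs s0.
have [e /= e0 eM] := (nbhs_ballP _ _).1 zM.
exists (ball z e); first exact: nbhsx_ballx.
apply/pseudomonotone_onP => x y [ex Jx] [ey Jy] xy p q Fp Fq.
have [U /open_nbhs_nbhs yU /pseudomonotone_onP pmU] := locF y Jy.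
have [u [Ju /andP[xu uy] Uu]] := dense_left hI dJ (JI _ Jx) (JI _ Jy) xy yU.
have [r Fr r0] : exists2 r, F u r & 0 < r.
  apply: MF (JI _ Ju); apply: eM.
  by move: ex ey; rewrite /ball /= !ltr_norml; lra.
have [_ /(_ r0) q0] :=
  pmU u y (conj Uu Ju) (conj (nbhs_singleton yU) Jy) uy r q Fr Fq.
by split=> // _; exact: ltW.
Qed.

Lemma local_trans_rel (R : realType) (I : set R) (P : R -> R -> Prop) :
  is_interval I ->
  (forall x y z, I y -> P x y -> P y z -> P x z) ->
  (forall z, I z -> exists2 e : R, 0 < e & forall x y : R,
    (ball z e `&` I) x -> (ball z e `&` I) y -> x < y -> P x y) ->
  forall x y, I x -> I y -> x < y -> P x y.
Proof.
move=> hI Ptr Ploc x y Ix Iy xy.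
(* The case [t = x] puts [x] in [S] without reflexivity of [P]. *)
pose S := [set t | x <= t <= y /\ (t = x \/ P x t)].
have Sx : S x by split; [lra|left].
have supS : has_sup S.
  by split; [exists x|exists y => t [/andP[]]].
have xc : x <= sup S by apply: ub_le_sup => //; exact: supS.2.
have cy : sup S <= y by apply: ge_sup => [|t [/andP[]]//]; exists x.
have Ic : I (sup S) by apply: (hI _ _ Ix Iy); lra.
have [e e0 Pe] := Ploc _ Ic.
have [t St ct] := sup_adherent e0 supS.
have tc : t <= sup S by apply: ub_le_sup => //; exact: supS.2.
(* Since [t] is within [e] of [sup S], one local step from [t] reaches every such [u], even beyond
   [sup S]; hence [sup S] cannot stop short of [y]. *)
have Su u : t < u -> u < sup S + e -> u <= y -> S u.
  move: (St) => [xty Pt] tu uc uy.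
  have It : I t := hI _ _ Ix Iy _ xty.
  have Iu : I u by apply: (hI _ _ Ix Iy); lra.
  have Ptu : P t u.
    by apply: Pe => //; split=> //; rewrite /ball /= ltr_norml; lra.
  split; first by lra.
  right; case: Pt => [<-//|Pxt].
  exact: Ptr Pxt Ptu.
have yc : y < sup S + e.
  rewrite ltNge; apply/negP => yc.
  have : S (sup S + e / 2) by apply: Su; lra.
  by move=> /(ub_le_sup supS.2); lra.
have [ty|yt] := ltP t y.
  by case: (Su y ty yc (lexx y)) => _ [yx|//]; lra.
by case: St => ? [|Pxt]; [lra|have -> : y = t by lra].
Qed.

Theorem theorem3p3 (R : realType) (I J : set R) (F : R -> set R)
  (hI : is_interval I)
  (hne : nonempty_valued_on I F)
  (hlsc : lsc_on I F)
  (hJ : dense_in I J)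
  (hloc : locally_pseudomonotone_on J F)
  (h0 : forall x, (I `\` J) x -> ~ F x 0) :
  pseudomonotone_on I F.
Proof.
apply/pseudomonotone_onP; apply: local_trans_rel => //.
  by move=> x y z /hne; exact: sign_le_trans.
move=> z Iz.
have [M zM pmM] := locally_pseudomonotone_dense hI hne hlsc hJ hloc h0 Iz.
(* Passing from [J] to [I] requires a convex neighbourhood, so [M] is shrunk to a ball. *)
have [e /= e0 eM] := (nbhs_ballP _ _).1 zM.
exists e => //; apply/pseudomonotone_onP.
apply: (pseudomonotone_on_dense hI hlsc hJ h0).
  move=> a b; rewrite /ball /= !ltr_norml => za zb c.
  by rewrite ltr_norml; lra.
by move=> x y s t [ex Jx] [ey Jy]; apply: pmM; split=> //; exact: eM.
Qed.
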